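(* Let $d\ge 2$ be an integer. For any positive integer $k$, the graph $\Lambda(d,k)$ is connected.
   Context: A lattice polytope is a polytope whose vertices all belong to $\mathbb{Z}^d$. Let $P\subset\mathbb{R}^d$ be a $d$-dimensional polytope with vertex set $\mathcal{V}$. A point $x\in\mathbb{R}^d\setminus P$ can be inserted in $P$ if the vertex set of the convex hull of $P\cup\{x\}$ is exactly $\mathcal{V}\cup\{x\}$; the insertion move then replaces $P$ by this convex hull. A vertex $v\in\mathcal{V}$ can be deleted from $P$ if the convex hull of $\mathcal{V}\setminus\{v\}$ is still $d$-dimensional; the deletion move then replaces $P$ by this convex hull. $\Lambda(d,k)$ is the undirected graph whose vertices are the $d$-dimensional lattice polytopes contained in the hypercube $[0,k]^d$ and whose edges connect two such polytopes when one is obtained from the other by a single insertion move (equivalently, the other by a single deletion move). *)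

(* Defs.v *)
From HB Require Import structures.
From Stdlib Require Import Relation_Operators.
From mathcomp Require Import all_boot all_order all_algebra.
From mathcomp Require Import all_classical all_reals.
From mathcomp Require Import convex.

Set Implicit Arguments.
Unset Strict Implicit.
Unset Printing Implicit Defensive.

Import Order.TTheory GRing.Theory Num.Theory.

Local Open Scope classical_set_scope.
Local Open Scope ring_scope.

Section Polytopes.
Context {R : realType} {d : nat}.
Implicit Types (A P Q : set 'rV[R]_d) (v x : 'rV[R]_d).

Definition convex_hull A : set 'rV[R]_d := smallest (@convex_set R 'rV[R]_d) A.

Definition affine_set A :=
  forall x y (t : R), A x -> A y -> A (t *: x + (1 - t) *: y).

Definition affine_hull A : set 'rV[R]_d := smallest affine_set A.

(* The dimension of A is the dimension of the linear space directing its
   affine hull; the empty set has no dimension. *)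
Definition has_dimension A (m : nat) :=
  exists (x0 : 'rV[R]_d) (U : {vspace 'rV[R]_d}),
    affine_hull A = [set x0 + u | u in [set` U]] /\ \dim U = m.

Definition polytope P :=
  exists A : set 'rV[R]_d, finite_set A /\ P = convex_hull A.

(* The vertices of a polytope are its extreme points. *)
Definition vertices P : set 'rV[R]_d :=
  [set v | P v /\ forall x y (t : R), P x -> P y -> 0 < t < 1 ->
             v = t *: x + (1 - t) *: y -> x = v /\ y = v].

Definition integer_points : set 'rV[R]_d :=
  [set x | forall i, x ord0 i \is a Num.int].

Definition lattice_polytope P := polytope P /\ vertices P `<=` integer_points.

Definition hypercube (k : nat) : set 'rV[R]_d :=
  [set x | forall i, 0 <= x ord0 i <= k%:R].

Definition insertable P x :=
  ~ P x /\ vertices (convex_hull (P `|` [set x])) = vertices P `|` [set x].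

Definition insertion_move P Q :=
  exists x, insertable P x /\ Q = convex_hull (P `|` [set x]).

Lemma insertion_move_irrefl P : ~ insertion_move P P.
Proof.
move=> [x [[Px _] PE]]; apply: Px; rewrite PE.
by apply: sub_gen_smallest; right.
Qed.

End Polytopes.

Record ugraph (T : Type) := UGraph {
  gvertex : set T;
  gedge : T -> T -> Prop;
  gedge_vertex : forall x y, gedge x y -> gvertex x /\ gvertex y;
  gedge_sym : forall x y, gedge x y -> gedge y x;
  gedge_irrefl : forall x, ~ gedge x x }.

Definition graph_connected (T : Type) (G : ugraph T) :=
  gvertex G !=set0 /\
  forall x y, gvertex G x -> gvertex G y -> clos_refl_trans T (gedge G) x y.

Section LatticePolytopeGraph.
Variables (R : realType) (d k : nat).
Implicit Types P Q : set 'rV[R]_d.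

Definition Lambda_vertex : set (set 'rV[R]_d) :=
  [set P | [/\ lattice_polytope P, has_dimension P d & P `<=` hypercube k]].

Definition Lambda_edge P Q :=
  [/\ Lambda_vertex P, Lambda_vertex Q & insertion_move P Q \/ insertion_move Q P].

Lemma Lambda_edge_vertex P Q :
  Lambda_edge P Q -> Lambda_vertex P /\ Lambda_vertex Q.
Proof. by case. Qed.

Lemma Lambda_edge_sym P Q : Lambda_edge P Q -> Lambda_edge Q P.
Proof. by move=> [VP VQ [PQ|QP]]; split=> //; [right|left]. Qed.

Lemma Lambda_edge_irrefl P : ~ Lambda_edge P P.
Proof. by move=> [_ _ [|]] /insertion_move_irrefl. Qed.

Definition Lambda : ugraph (set 'rV[R]_d) :=
  UGraph Lambda_edge_vertex Lambda_edge_sym Lambda_edge_irrefl.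

End LatticePolytopeGraph.

(* Main.v *)
Require Import Defs.
From Stdlib Require Import Relation_Operators.
From mathcomp Require Import all_boot all_order all_algebra.
From mathcomp Require Import all_classical all_reals.
From mathcomp Require Import interval_inference convex ring lra.

(** The idea is to replace every polytope by a simplex, to push the vertices of
the simplex to corners of the cube one coordinate at a time, and to observe
that any simplex on corners of the cube is joined to the cube itself.

Sets of lattice points rather than polytopes carry the argument. A set A is
in convex position when no point of A lies in the convex hull of the others; A
is then the vertex set of its hull ([vertices_convex_position]). If A is finite
and in convex position and B is a subset of A that spans the space affinely,
then inserting the points of A \ B one after the other is a path from the hull
of B to the hull of A ([reachable_sub]). Three consequences follow.
- Every polytope is joined to a simplex on some of its vertices.
- The corners of the cube are in convex position, so every simplex whose
  vertices are corners is joined to the cube.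
- A vertex of a simplex at which the barycentric coordinate of a lattice point
  x is nonzero can be exchanged for x whenever the d + 2 points at hand are in
  convex position. This holds as soon as two coordinates of x are positive and
  one is negative: neither side of the Radon partition is then a single point
  ([exchange]).

It remains to bring any simplex to the corners. Fix a coordinate i, write the
i-th basis vector as a combination, with coefficients a_j of sum 0, of the
vertices v_j, and let w be a vertex whose i-th coordinate is neither 0 nor k.
The point v_g + t e_i has barycentric coordinates delta_gj + t a_j, so the
signs of the a_j decide which points on the vertical lines through the
vertices can be inserted. Write a_w for the coefficient at w.
- If a takes both signs away from w, then w itself can slide to the top or to
  the bottom of the cube ([improvable_mixed]).
- Otherwise, up to turning e_i over, a_w > 0 and the other coefficients are
  nonpositive, so the vertical line through w enters the simplex. If only one
  of them is nonzero, then e_i is parallel to an edge at w. As d >= 2 there is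
  a third vertex g, and w can be exchanged for a point at an end of the
  vertical line through g ([improvable_edge]).
- If at least two of them are negative and some vertex g other than w is not
  at the bottom, w can be exchanged for the point at the bottom below g. If
  every vertex but w is at the bottom, w is first exchanged for the point one
  unit above some other vertex; this creates a vertical edge, and the argument
  for such an edge applies ([improvable_apex]).
Each time a point whose i-th coordinate is extreme replaces w. That point lies
on the vertical line through an old vertex, so coordinates other than i that
are already extreme on all the vertices stay so ([straighten]), and the
coordinates can be treated one after the other. *)

Set Implicit Arguments.
Unset Strict Implicit.
Unset Printing Implicit Defensive.

Import Order.TTheory GRing.Theory Num.Theory.

Local Open Scope classical_set_scope.
Local Open Scope ring_scope.

(** * Sets in convex position *)

Section ConvexPosition.
Context {R : realType} {d : nat}.
Implicit Types (A B C P Q : set 'rV[R]_d) (a v x y : 'rV[R]_d).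

(** Convexity with real numbers as weights instead of elements of a subtype. *)
Lemma convex_setP A : convex_set A <->
  forall x y (t : R), 0 <= t <= 1 -> A x -> A y -> A (t *: x + (1 - t) *: y).
Proof.
split=> cA x y t; last first.
  move=> /set_mem Ax /set_mem Ay.
  by apply/mem_set/cA => //; rewrite ge0 le1.
move=> /andP[t0 t1] Ax Ay.
by have := cA x y (Itv01 t0 t1) (mem_set Ax) (mem_set Ay) => /set_mem.
Qed.

Lemma sub_convex_hull A : A `<=` convex_hull A.
Proof. exact: sub_gen_smallest. Qed.

Lemma convex_hull_min A C : convex_set C -> A `<=` C -> convex_hull A `<=` C.
Proof. exact: smallest_sub. Qed.

Lemma convex_hull_convex A x y (t : R) : 0 <= t <= 1 ->
  convex_hull A x -> convex_hull A y -> convex_hull A (t *: x + (1 - t) *: y).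
Proof.
move=> t01 Ax Ay C [cC AC]; have /convex_setP := cC; apply => //.
  exact: Ax.
exact: Ay.
Qed.

Lemma convex_set_hull A : convex_set (convex_hull A).
Proof. by apply/convex_setP => x y t; exact: convex_hull_convex. Qed.

Lemma convex_hullS A B : A `<=` B -> convex_hull A `<=` convex_hull B.
Proof.
move=> AB; apply: convex_hull_min; first exact: convex_set_hull.
exact: subset_trans (@sub_convex_hull B).
Qed.

Lemma convex_hull_absorb A B :
  A `<=` B -> B `<=` convex_hull A -> convex_hull B = convex_hull A.
Proof.
move=> AB BA; apply/seteqP; split; last exact: convex_hullS.
by apply: convex_hull_min => //; exact: convex_set_hull.
Qed.

Lemma convex_hullU_hull A B :
  convex_hull (convex_hull A `|` B) = convex_hull (A `|` B).
Proof.
apply: convex_hull_absorb.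
  by apply: setSU; exact: sub_convex_hull.
move=> x [|Bx]; first by apply: convex_hullS; exact: subsetUl.
by apply: sub_convex_hull; right.
Qed.

Definition convex_position A := forall a, A a -> ~ convex_hull (A `\ a) a.

Lemma convex_positionS A B : A `<=` B -> convex_position B -> convex_position A.
Proof.
move=> AB cB a Aa Aha; apply: (cB a (AB _ Aa)); apply: convex_hullS Aha.
exact: setSD.
Qed.

(** Removing an extreme point from a convex set leaves it convex, so an extreme
point of the hull outside A could be removed from the hull. *)
Lemma vertices_sub A : vertices (convex_hull A) `<=` A.
Proof.
move=> v [Av vext]; apply: contrapT => nAv.
suff /(_ _ Av)[_ /(_ erefl)] : convex_hull A `<=` convex_hull A `\ v by [].
apply: convex_hull_min => [|x Ax]; last first.
  by split; [exact: sub_convex_hull|move=> xv; apply: nAv; rewrite -xv].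
apply/convex_setP => x y t t01 [Ax xv] [Ay yv]; split=> [|/= E].
  exact: convex_hull_convex.
case: (eqVneq t 0) E => [->|t0 E].
  by rewrite scale0r add0r subr0 scale1r.
case: (eqVneq t 1) E => [->|t1 E].
  by rewrite subrr scale0r addr0 scale1r.
have tt : 0 < t < 1.
  by case/andP: t01 => ? ?; apply/andP; rewrite lt_def t0 lt_neqAle t1.
by have [/xv] := vext _ _ _ Ax Ay tt (esym E).
Qed.

(** For a in A, the hull of A consists of a and of the union J of the half-open
segments from the hull C of the other points to a. As C misses a, so does J.
A proper convex combination of two points of the hull that involves a point of
J is again in J, hence different from a: this is the extremality of a. *)
Lemma vertices_convex_position A :
  convex_position A -> vertices (convex_hull A) = A.
Proof.
move=> cA; apply/seteqP; split; first exact: vertices_sub.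
move=> a Aa; split; first exact: sub_convex_hull.
pose C := convex_hull (A `\ a).
(* [J false] also allows the end point a of the segments. *)
pose J b x := exists s c, [/\ 0 <= s <= 1, (b : bool) ==> (s < 1), C c &
  x = s *: a + (1 - s) *: c].
have aJ : ~ J true a.
  move=> [s [c [/andP[s0 s1] /= s1' Cc E]]]; apply: (cA a Aa).
  suff ac : a = c by rewrite {2}ac.
  apply: (@scalerI _ _ (1 - s)); first by rewrite lt0r_neq0 // subr_gt0.
  by rewrite scalerBl scale1r {1}E [s *: a + _]addrC addrK.
have JJ x y t : 0 < t <= 1 -> J true x -> J false y ->
    J true (t *: x + (1 - t) *: y).
  move=> /andP[t0 t1] [s [c [/andP[s0 s1] /= s1' Cc ->]]].
  move=> [s' [c' [/andP[s0' s1''] _ Cc' ->]]].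
  have q0 : 0 < 1 - (t * s + (1 - t) * s') by nra.
  exists (t * s + (1 - t) * s').
  pose r := t * (1 - s) / (1 - (t * s + (1 - t) * s')).
  exists (r *: c + (1 - r) *: c'); split.
  - by apply/andP; split; nra.
  - by rewrite /= -subr_gt0.
  - apply: convex_hull_convex => //; rewrite /r divr_ge0 //= ?(ltW q0) //.
      by rewrite ler_pdivrMr // mul1r; nra.
    by rewrite mulr_ge0 // ?(ltW t0) // subr_ge0.
  - apply/rowP => j; rewrite !mxE /r; field.
    exact: lt0r_neq0.
have Jw x : J true x -> J false x.
  by move=> [s [c [? ? ? ?]]]; exists s, c; split.
have JA c : J true c -> J false a.
  move=> [_ [c' [_ _ Cc' _]]]; exists 1, c'; split=> //.
    by rewrite lexx ler01.
  by rewrite subrr scale1r scale0r addr0.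
have H : convex_hull A `<=` [set x | x = a \/ J true x].
  apply: convex_hull_min; last first.
    move=> x Ax; case: (pselect (x = a)) => xa; [by left|right].
    exists 0, x; split=> //=; first by rewrite lexx ler01.
      by apply: sub_convex_hull; split.
    by rewrite scale0r add0r subr0 scale1r.
  apply/convex_setP => x y t /andP[t0 t1] [->|Jx] [->|Jy] /=.
  - by left; rewrite -scalerDl addrC subrK scale1r.
  - case: (eqVneq t 1) => [->|t1'].
      by left; rewrite subrr scale0r addr0 scale1r.
    right; have -> : t *: a + (1 - t) *: y = (1 - t) *: y + (1 - (1 - t)) *: a.
      by rewrite subKr addrC.
    apply: JJ => //; last exact: JA Jy.
    by rewrite subr_gt0 lt_neqAle t1' t1 gerBl.
  - case: (eqVneq t 0) => [->|t0'].
      by left; rewrite scale0r add0r subr0 scale1r.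
    right; apply: JJ => //; last exact: JA Jx.
    by rewrite lt_def t0' t0.
  - right; case: (eqVneq t 0) => [->|t0'].
      by rewrite scale0r add0r subr0 scale1r.
    apply: JJ => //; last exact: Jw.
    by rewrite lt_def t0' t0.
have nJ x y t : 0 < t < 1 -> convex_hull A y ->
    a = t *: x + (1 - t) *: y -> J true x -> False.
  move=> /andP[t0 t1] Ay E Jx; apply: aJ; rewrite E; apply: JJ => //.
    by rewrite t0 ltW.
  by have [->|/Jw//] := H _ Ay; exact: JA Jx.
move=> x y t Ax Ay t01 E; split.
  by have [//|/(nJ x y t t01 Ay E)] := H _ Ax.
have [//|] := H _ Ay.
case/andP: t01 => t0 t1.
have t01' : 0 < 1 - t < 1 by apply/andP; split; lra.
by move=> /(nJ y x _ t01' Ax) []; rewrite E subKr addrC.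
Qed.

(** Discard, one at a time, points that lie in the hull of the others. *)
Lemma convex_position_sub (s : seq 'rV[R]_d) : exists A,
  [/\ A `<=` [set` s], convex_position A &
      convex_hull A = convex_hull [set` s]].
Proof.
have [n] := ubnP (size s); elim: n s => // n IH s /ltnSE sn.
case: (pselect (convex_position [set` s])) => [cs|].
  by exists [set` s]; split.
move=> /existsNP[a] /not_implyP[/= sa /contrapT ha].
pose s' := [seq x <- s | predC1 a x].
have s'E : [set` s'] = [set` s] `\ a.
  apply/seteqP; split=> x /=; rewrite mem_filter /=.
    by move=> /andP[/eqP].
  by move=> [xs /eqP ->].
have ss' : (size s' < n)%N.
  apply: leq_trans sn; rewrite size_filter -(count_predC (pred1 a) s).
  by rewrite -[X in (X < _)%N]add0n ltn_add2r -has_count has_pred1.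
have [A [As cA hA]] := IH _ ss'; exists A; split=> //.
  by apply: subset_trans As _; rewrite s'E; exact: subDsetl.
rewrite hA s'E; apply/esym/convex_hull_absorb; first exact: subDsetl.
move=> x sx; case: (pselect (x = a)) => [->//|xa].
by apply: sub_convex_hull.
Qed.

Lemma polytope_vertices P : polytope P ->
  [/\ finite_set (vertices P), convex_position (vertices P) &
      convex_hull (vertices P) = P].
Proof.
move=> [A0 [/finite_seqP[s ->] ->]].
have [A [As cA <-]] := convex_position_sub s.
rewrite vertices_convex_position //; split=> //.
exact: sub_finite_set As (finite_seq s).
Qed.

End ConvexPosition.

(** * Affine spans and homogeneous coordinates *)

Section AffineSpan.
Context {R : realType} {d : nat}.
Implicit Types (A B C P Q : set 'rV[R]_d) (a v x y : 'rV[R]_d).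

Definition spanning A := affine_hull A = setT.

Lemma affine_set_hull A : affine_set (affine_hull A).
Proof.
move=> x y t Ax Ay C CA; case: (CA) => aC _.
by apply: aC; [exact: Ax CA|exact: Ay CA].
Qed.

Lemma affine_hull_min A C : affine_set C -> A `<=` C -> affine_hull A `<=` C.
Proof. exact: smallest_sub. Qed.

Lemma affine_hullS A B : A `<=` B -> affine_hull A `<=` affine_hull B.
Proof.
move=> AB; apply: affine_hull_min; first exact: affine_set_hull.
by apply: subset_trans AB _; exact: sub_gen_smallest.
Qed.

Lemma spanningS A B : A `<=` B -> spanning A -> spanning B.
Proof.
move=> AB sA; apply/seteqP; split=> // x _.
by apply: (affine_hullS AB); rewrite sA.
Qed.

Lemma has_dimension_spanning A : has_dimension A d <-> spanning A.
Proof.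
have dT : \dim (fullv : {vspace 'rV[R]_d}) = d by rewrite dimvf /dim /= mul1n.
split=> [[x0 [U [E dU]]]|sA]; last first.
  exists 0, fullv; split=> //; rewrite sA; apply/seteqP; split=> x //= _.
  by exists x; rewrite ?add0r //= memvf.
have UT : U = fullv by apply/eqP; rewrite eqEdim subvf /= dT dU.
rewrite /spanning E; apply/seteqP; split=> x //= _.
by exists (x - x0); rewrite ?subrKC // UT /= memvf.
Qed.

Lemma spanning_hull A : spanning (convex_hull A) <-> spanning A.
Proof.
split=> [sA|]; last by apply: spanningS; exact: sub_convex_hull.
apply/seteqP; split=> // x _.
have : affine_hull (convex_hull A) x by rewrite sA.
apply: affine_hull_min x; first exact: affine_set_hull.
apply: convex_hull_min; last exact: sub_gen_smallest.
by apply/convex_setP => x y t _; exact: affine_set_hull.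
Qed.

Lemma affine_set_scale B b u (t : R) : affine_set B -> B b -> B (b + u) ->
  B (b + t *: u).
Proof.
move=> aB Bb Bu; suff -> : b + t *: u = t *: (b + u) + (1 - t) *: b by exact: aB.
by apply/rowP => j; rewrite !mxE; ring.
Qed.

(** The sum of u and v is twice their midpoint; this is how the binary affine
combinations in the definition yield the directing linear space. *)
Lemma affine_set_add B b u v : affine_set B -> B b -> B (b + u) ->
  B (b + v) -> B (b + (u + v)).
Proof.
move=> aB Bb Bu Bv.
have /(affine_set_scale 2 aB Bb) : B (b + 2^-1 *: (u + v)).
  suff -> : b + 2^-1 *: (u + v) = 2^-1 *: (b + u) + (1 - 2^-1) *: (b + v).
    exact: aB.
  by apply/rowP => j; rewrite !mxE; field.
by rewrite scalerA divff ?scale1r // pnatr_eq0.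
Qed.

Lemma affine_set_sum B b (I : finType) (c : I -> R) (u : I -> 'rV[R]_d) :
  affine_set B -> B b -> (forall i, B (b + u i)) ->
  B (b + \sum_i c i *: u i).
Proof.
move=> aB Bb Bu; elim/big_ind: _ => [|x y Bx By|i _]; first by rewrite addr0.
  exact: affine_set_add.
exact: affine_set_scale.
Qed.

(** Points as vectors of height 1: affine relations between points become linear
relations, and directions become vectors of height 0. *)
Definition homog x : 'rV[R]_(1 + d) := row_mx 1%:M x.

Definition homog_mx n (v : 'I_n -> 'rV[R]_d) : 'M[R]_(n, 1 + d) :=
  \matrix_i homog (v i).

Lemma homogD x y : homog (x + y) = homog x + row_mx 0 y.
Proof. by rewrite /homog add_row_mx addr0. Qed.

Lemma homog_affine x y (t : R) :
  homog (t *: x + (1 - t) *: y) = t *: homog x + (1 - t) *: homog y.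
Proof.
by rewrite /homog !scale_row_mx add_row_mx -scalerDl [t + _]addrC subrK scale1r.
Qed.

(** A linear relation K between the columns is an affine function that vanishes
on the points; its zero set is affine, so it is everything. *)
Lemma spanning_row_full n (v : 'I_n -> 'rV[R]_d) :
  spanning (range v) -> row_full (homog_mx v).
Proof.
move=> sv; rewrite -cokermx_eq0; apply/eqP.
set K := cokermx _.
have HK x : homog x *m K = 0.
  have : affine_hull (range v) x by rewrite sv.
  apply: (@affine_hull_min _ [set x | homog x *m K = 0]) x.
    move=> x y t /= xK yK.
    by rewrite homog_affine mulmxDl -!scalemxAl xK yK !scaler0 addr0.
  move=> _ [i _ <-] /=; rewrite -[homog _](rowK (fun i => homog (v i))) -row_mul.
  by rewrite mulmx_coker row0.
apply/row_matrixP => i; rewrite row0 rowE.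
set r := delta_mx _ _.
have -> : r = r 0 0 *: homog 0 + (homog (rsubmx r) - homog 0).
  rewrite /homog scale_row_mx opp_row_mx !add_row_mx subrr scaler0 subr0.
  rewrite addr0 add0r -[LHS]hsubmxK; congr row_mx.
  apply/rowP => j; rewrite ord1 [LHS]mxE [RHS]mxE [1%:M _ _]mxE eqxx mulr1.
  by congr (r 0 _); exact/val_inj.
by rewrite mulmxDl mulmxBl -scalemxAl !HK subr0 scaler0 addr0.
Qed.

Lemma homog_mx_mul n (v : 'I_n -> 'rV[R]_d) (u : 'rV[R]_n) :
  u *m homog_mx v = row_mx (\sum_i u 0 i)%:M (\sum_i u 0 i *: v i).
Proof.
rewrite mulmx_sum_row; under eq_bigr do rewrite rowK /homog scale_row_mx.
apply/rowP => j; rewrite summxE; case: (split_ordP j) => {}j ->.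
  rewrite row_mxEl ord1 !mxE mulr1n; apply: eq_bigr => i _.
  by rewrite row_mxEl !mxE mulr1.
by rewrite row_mxEr summxE; apply: eq_bigr => i _; rewrite row_mxEr.
Qed.

Lemma row_full_spanning n (v : 'I_n -> 'rV[R]_d) :
  row_full (homog_mx v) -> spanning (range v).
Proof.
move=> fv; apply/seteqP; split=> // x _.
have /submxP[u E] : (homog x <= homog_mx v)%MS by exact: submx_full.
move: E; rewrite homog_mx_mul => /eq_row_mx[/matrixP/(_ 0 0)].
rewrite !mxE !mulr1n => s1 ->.
have [i0 _] : exists i : 'I_n, True.
  case: n v u fv s1 => [|n] v u _ s1; last by exists ord0.
  by move/eqP: s1; rewrite big_ord0 oner_eq0.
have -> : \sum_i u 0 i *: v i = v i0 + \sum_i u 0 i *: (v i - v i0).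
  under [X in _ = _ + X]eq_bigr do rewrite scalerBr.
  by rewrite sumrB -scaler_suml -s1 scale1r addrC subrK.
have vB i : affine_hull (range v) (v i) by apply: sub_gen_smallest; exists i.
apply: affine_set_sum => //; first exact: affine_set_hull.
by move=> i; rewrite subrKC.
Qed.

End AffineSpan.

(** * Lattice point sets and paths of moves *)

Section Connectivity.
Context {R : realType} {d : nat} (k : nat).
Implicit Types (A B C P Q : set 'rV[R]_d) (a v x y : 'rV[R]_d).

Definition grid : set 'rV[R]_d := integer_points `&` hypercube k.

Definition reachable := clos_refl_trans _ (gedge (Lambda R d k)).

Lemma reachable_sym P Q : reachable P Q -> reachable Q P.
Proof.
elim=> [{}P {}Q PQ|{}P|{}P {}Q S _ QP _ SQ].
- by apply: rt_step; exact: gedge_sym PQ.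
- exact: rt_refl.
- exact: rt_trans SQ QP.
Qed.

Lemma hypercube_convex : convex_set (@hypercube R d k).
Proof.
apply/convex_setP => x y t /andP[t0 t1] Cx Cy i; rewrite !mxE.
by have /andP[? ?] := Cx i; have /andP[? ?] := Cy i; apply/andP; split; nra.
Qed.

Lemma Lambda_vertex_hull A : finite_set A -> convex_position A ->
  A `<=` grid -> spanning A -> Lambda_vertex k (convex_hull A).
Proof.
move=> fA cA AL sA; split.
- split; first by exists A.
  by rewrite vertices_convex_position // => x /AL[].
- exact/has_dimension_spanning/spanning_hull.
- by apply: convex_hull_min => [|x /AL[]//]; exact: hypercube_convex.
Qed.

Lemma Lambda_edge_insert A a :
  finite_set A -> convex_position (A `|` [set a]) ->
  A `|` [set a] `<=` grid -> spanning A -> ~ A a ->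
  Lambda_edge k (convex_hull A) (convex_hull (A `|` [set a])).
Proof.
move=> fA cA AL sA Aa.
have AAa : A `<=` A `|` [set a] by exact: subsetUl.
have cA' := convex_positionS AAa cA.
split.
- by apply: Lambda_vertex_hull => //; exact: subset_trans AL.
- by apply: Lambda_vertex_hull => //; [rewrite finite_setU|exact: spanningS sA].
- left; exists a; rewrite convex_hullU_hull; split=> //; split.
    move=> Aha; apply: (cA a); first by right.
    apply: convex_hullS Aha => x Ax; split; first by left.
    by move=> xa; apply: Aa; rewrite -xa.
  by rewrite convex_hullU_hull !vertices_convex_position.
Qed.

(** The points of A outside B can be inserted in any order, because every set
between B and A is in convex position and spanning. *)
Lemma reachable_sub A B : finite_set A -> convex_position A -> A `<=` grid ->
  B `<=` A -> spanning B -> reachable (convex_hull B) (convex_hull A).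
Proof.
move=> fA cA AL BA sB.
suff H (s : seq 'rV[R]_d) : [set` s] `<=` A ->
    reachable (convex_hull B) (convex_hull (B `|` [set` s])).
  have /finite_seqP[s sE] := fA.
  by have := H s; rewrite -sE setUidr //; apply.
elim: s => [_|a s IH sA].
  by rewrite set_nil setU0; exact: rt_refl.
have sA' : [set` s] `<=` A by move=> x xs; apply: sA; rewrite /= inE xs orbT.
have -> : B `|` [set` a :: s] = (B `|` [set` s]) `|` [set a].
  apply/seteqP; split=> x /=; rewrite inE.
    by move=> [?|/orP[/eqP ?|?]]; [left; left|right|left; right].
  by move=> [[?|->]|->]; [left|right; rewrite orbT|right; rewrite eqxx].
apply: rt_trans (IH sA') _.
case: (pselect ((B `|` [set` s]) a)) => [aBs|aBs].
  suff -> : (B `|` [set` s]) `|` [set a] = B `|` [set` s] by exact: rt_refl.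
  by apply: setUidl => x ->.
have BsA : B `|` [set` s] `|` [set a] `<=` A.
  move=> x [[/BA//|/sA'//]|->]; apply: sA; rewrite /= inE eqxx //.
apply/rt_step/Lambda_edge_insert => //.
- by apply: sub_finite_set fA => x [/BA|/sA'].
- exact: convex_positionS cA.
- exact: subset_trans AL.
- by apply: spanningS sB => x; left.
Qed.

End Connectivity.

(** * Exchanging a vertex of a simplex *)

Section Exchange.
Context {R : realType} {d : nat}.
Implicit Types (A B C P Q : set 'rV[R]_d) (a x y e : 'rV[R]_d).
Implicit Types v : 'I_(1 + d) -> 'rV[R]_d.

Lemma convex_hull_separated A a (f : 'rV[R]_d -> R) :
  (forall x y t, f (t *: x + (1 - t) *: y) = t * f x + (1 - t) * f y) ->
  (forall x, A x -> f x <= 0) -> 0 < f a -> ~ convex_hull A a.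
Proof.
move=> fA A0 fa; have cf : convex_set [set x | f x <= 0].
  apply/convex_setP => x y t /andP[t0 t1] /= fx fy; rewrite fA.
  by have := subr_ge0 t 1; rewrite t1; nra.
by move=> /(convex_hull_min cf A0) /=; rewrite leNgt fa.
Qed.

Definition simplex v := homog_mx v \in unitmx.

Definition coords v (h : 'rV[R]_(1 + d)) := h *m invmx (homog_mx v).
Definition bary v x j := coords v (homog x) 0 j.
Definition dir_coord v e j := coords v (row_mx 0 e) 0 j.

Lemma bary_affine v j x y (t : R) :
  bary v (t *: x + (1 - t) *: y) j = t * bary v x j + (1 - t) * bary v y j.
Proof. by rewrite /bary /coords homog_affine mulmxDl -!scalemxAl !mxE. Qed.

Lemma bary_vertex v i j : simplex v -> bary v (v i) j = (j == i)%:R.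
Proof.
move=> sv; rewrite /bary /coords -[homog _](rowK (fun i => homog (v i))) -row_mul.
by rewrite mulmxV // !mxE eq_sym.
Qed.

Lemma bary_translate v i e (t : R) j : simplex v ->
  bary v (v i + t *: e) j = (j == i)%:R + t * dir_coord v e j.
Proof.
move=> sv; rewrite -(bary_vertex i j sv) /bary /dir_coord /coords homogD mulmxDl mxE.
by rewrite -[in LHS](scaler0 _ t) -scale_row_mx -scalemxAl [X in _ + X]mxE.
Qed.

Lemma dir_coord_vertices v i i' j : simplex v ->
  dir_coord v (v i - v i') j = (j == i)%:R - (j == i')%:R.
Proof.
move=> sv; rewrite -!(bary_vertex _ _ sv) /bary /dir_coord /coords.
have -> : row_mx 0 (v i - v i') = homog (v i) - homog (v i').
  by rewrite /homog opp_row_mx add_row_mx subrr.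
by rewrite mulmxBl !mxE.
Qed.

Lemma dir_coord_sum v e : simplex v ->
  \sum_j dir_coord v e j = 0 /\ \sum_j dir_coord v e j *: v j = e.
Proof.
move=> sv; have := homog_mx_mul v (coords v (row_mx 0 e)).
rewrite mulmxKV // => /eq_row_mx[/matrixP/(_ 0 0)].
by rewrite !mxE mulr1n => /esym ? /esym ?.
Qed.

Definition upd v u x j := if j == u then x else v j.

Lemma upd_same v u x : upd v u x u = x.
Proof. by rewrite /upd eqxx. Qed.

Lemma upd_other v u x j : j != u -> upd v u x j = v j.
Proof. by rewrite /upd => /negbTE ->. Qed.

(** If the coordinate of x at u is nonzero, then v u is a combination of x and
the other vertices. *)
Lemma simplex_upd v u x : simplex v -> bary v x u != 0 -> simplex (upd v u x).
Proof.
move=> sv xu; rewrite /simplex -row_full_unit -sub1mx.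
apply: submx_trans (_ : (homog_mx v <= _)%MS); first by rewrite sub1mx row_full_unit.
have sub j : (homog (upd v u x j) <= homog_mx (upd v u x))%MS.
  rewrite -[homog _](rowK (fun i => homog (upd v u x i))); exact: row_sub.
apply/row_subP => i; rewrite rowK; case: (eqVneq i u) => [->|iu]; last first.
  by have := sub i; rewrite upd_other.
have E : homog x = \sum_j bary v x j *: homog (v j).
  rewrite -[LHS](mulmxKV sv) mulmx_sum_row.
  by apply: eq_bigr => j _; rewrite rowK.
rewrite (bigD1 u) //= in E.
have -> : homog (v u) = (bary v x u)^-1 *:
    (homog x - \sum_(j | j != u) bary v x j *: homog (v j)).
  by rewrite E addrK scalerA mulVf // scale1r.
apply/scalemx_sub/addmx_sub; first by have := sub u; rewrite upd_same.
rewrite eqmx_opp; apply: summx_sub => j ju; apply: scalemx_sub.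
by have := sub j; rewrite upd_other.
Qed.

Lemma spanning_simplex v : simplex v -> spanning (range v).
Proof. by move=> sv; apply: row_full_spanning; rewrite row_full_unit. Qed.

(** Each of the d + 2 points is cut off from the others by a combination of at
most two barycentric coordinates. The point x has a negative coordinate, which
the vertices do not. For a vertex v i, the i-th coordinate does the job unless
it is positive at x; in that case a second positive coordinate m of x allows
the multiple of the m-th coordinate to be subtracted that makes the function
vanish at x. *)
Lemma convex_position_exchange v x p q n : simplex v -> p != q ->
  0 < bary v x p -> 0 < bary v x q -> bary v x n < 0 ->
  convex_position (range v `|` [set x]).
Proof.
move=> sv pq xp xq xn a ax; case: (pselect (a = x)) ax => [->|aNx] ax.
  apply: (convex_hull_separated (f := fun y => - bary v y n)).
  - by move=> y z t; rewrite bary_affine; ring.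
  - move=> y [[[i _ <-] _|-> xx]]; last by case: xx.
    by rewrite bary_vertex // oppr_le0.
  - by rewrite oppr_gt0.
have {ax aNx} [i _ <-] : range v a by case: ax.
have rest y : ((range v `|` [set x]) `\ v i) y ->
    y = x \/ exists2 j, j != i & y = v j.
  move=> [[[j _ <-]|->] ji]; [right|by left].
  by exists j => //; apply/eqP => E; apply: ji; rewrite E.
case: (leP (bary v x i) 0) => xi.
  apply: (convex_hull_separated (f := fun y => bary v y i)).
  - by move=> y z t; rewrite bary_affine.
  - move=> y /rest[->//|[j ji ->]].
    by rewrite bary_vertex // eq_sym (negbTE ji).
  - by rewrite bary_vertex // eqxx.
have [m mi xm] : exists2 m, m != i & 0 < bary v x m.
  by case: (eqVneq p i) => [pi|]; [exists q; rewrite // -pi eq_sym|exists p].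
apply: (convex_hull_separated
  (f := fun y => bary v y i - bary v x i / bary v x m * bary v y m)).
- by move=> y z t; rewrite !bary_affine; ring.
- move=> y /rest[->|[j ji ->]]; first by rewrite divfK ?subrr // lt0r_neq0.
  rewrite !bary_vertex // eq_sym (negbTE ji) sub0r oppr_le0.
  by rewrite mulr_ge0 // divr_ge0 // ltW.
- by rewrite !bary_vertex // eqxx (negbTE mi) mulr0 subr0.
Qed.

Variable k : nat.

Definition grid_simplex v := simplex v /\ forall j, grid k (v j).

(** The d + 2 points are in convex position and contain both simplices. *)
Lemma exchange v u x p q n : grid_simplex v -> grid k x -> p != q ->
  0 < bary v x p -> 0 < bary v x q -> bary v x n < 0 -> bary v x u != 0 ->
  grid_simplex (upd v u x) /\
  reachable k (convex_hull (range v)) (convex_hull (range (upd v u x))).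
Proof.
move=> [sv gv] gx pq xp xq xn xu; have su := simplex_upd sv xu.
split; first by split=> // j; rewrite /upd; case: eqP.
have cA := convex_position_exchange sv pq xp xq xn.
have gA : range v `|` [set x] `<=` grid k by move=> _ [[j _ <-]|->].
have fA : finite_set (range v `|` [set x]).
  by rewrite finite_setU; split => //; exact: finite_image.
apply: rt_trans (reachable_sym _).
  apply: (reachable_sub fA cA gA); last exact: spanning_simplex.
  exact: subsetUl.
apply: (reachable_sub fA cA gA); last exact: spanning_simplex.
by move=> _ [j _ <-]; rewrite /upd; case: eqP => _; [right|left; exists j].
Qed.

End Exchange.

(** * Making one coordinate of one vertex extreme *)

Section Step.
Context {R : realType} {d : nat}.
Variables (k : nat) (i : 'I_d).
Hypothesis d_ge2 : (2 <= d)%N.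
Implicit Types (x y e : 'rV[R]_d) (b : bool).
Implicit Types v : 'I_(1 + d) -> 'rV[R]_d.

Definition extreme x := (x 0 i == 0) || (x 0 i == k%:R).

(** The boolean selects the orientation of the i-th axis, so that heights are
measured from the bottom or from the top of the cube. *)
Definition axis b : 'rV[R]_d := (if b then -1 else 1) *: delta_mx 0 i.
Definition height b x : R := if b then k%:R - x 0 i else x 0 i.

Lemma height_translate b x (t : R) :
  height b (x + t *: axis b) = height b x + t.
Proof. by rewrite /height /axis; case: b; rewrite !mxE !eqxx /=; ring. Qed.

Lemma axis_other b x (t : R) j : j != i -> (x + t *: axis b) 0 j = x 0 j.
Proof. by move=> ji; rewrite !mxE (negbTE ji) andbF !mulr0 addr0. Qed.

Lemma extreme_height b x :
  extreme x = (height b x == 0) || (height b x == k%:R).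
Proof.
rewrite /extreme /height; case: b => //.
rewrite orbC subr_eq0 [k%:R == x 0 i]eq_sym; congr (_ || _).
by rewrite -subr_eq0 -[RHS]subr_eq0 addrAC subrr add0r oppr_eq0 subr0.
Qed.

Lemma grid_height b x : grid k x ->
  [/\ height b x \is a Num.int, 0 <= height b x & height b x <= k%:R].
Proof.
move=> [xZ xk]; have xZi := xZ i; have /andP[x0 x1] := xk i; rewrite /height.
case: b; split=> //; first by rewrite rpredB // rpred_nat.
  by rewrite subr_ge0.
by rewrite gerBl.
Qed.

Lemma grid_translate b x (t : R) : grid k x -> t \is a Num.int ->
  0 <= height b x + t <= k%:R -> grid k (x + t *: axis b).
Proof.
move=> [xZ xk] tZ ht; split=> j; (case: (eqVneq j i) => [->|ji];
  last by rewrite axis_other).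
  by rewrite !mxE !eqxx mulr1 rpredD // rpredM //; case: (b); rewrite ?rpredN rpred1.
move: ht; rewrite -height_translate /height; case: b => // /andP[h0 h1].
by apply/andP; split; lra.
Qed.

(** Moving by one unit along the axis raises the height by 1, and the height is
an affine function. *)
Lemma height_direction b v : simplex v ->
  \sum_j dir_coord v (axis b) j * height b (v j) = 1.
Proof.
move=> sv; have [s0 sE] := dir_coord_sum (axis b) sv.
have := congr1 (fun x : 'rV_d => x 0 i) sE; rewrite summxE.
rewrite /height; case: b s0 sE => s0 sE; rewrite !mxE !eqxx mulr1 => E1.
  under eq_bigr do rewrite mulrBr.
  rewrite sumrB -mulr_suml s0 mul0r sub0r -[RHS]opprK; congr (- _).
  by rewrite -E1; apply: eq_bigr => j _; rewrite !mxE.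
by rewrite -E1; apply: eq_bigr => j _; rewrite !mxE.
Qed.

(** The new vertex lies on the line through an old vertex parallel to the i-th
axis, so it inherits extremality in the other coordinates. *)
Definition improvable v w := exists x g,
  [/\ extreme x, forall j, j != i -> x 0 j = v g 0 j,
      grid_simplex k (upd v w x) &
      reachable k (convex_hull (range v)) (convex_hull (range (upd v w x)))].

(** The function [l] gives the barycentric coordinates of the inserted point. *)
Lemma improvableI b v w g (t : R) p q n : grid_simplex k v ->
  t \is a Num.int ->
  (height b (v g) + t == 0) || (height b (v g) + t == k%:R) ->
  p != q ->
  let l j := (j == g)%:R + t * dir_coord v (axis b) j in
  0 < l p -> 0 < l q -> l n < 0 -> l w != 0 -> improvable v w.
Proof.
move=> gv tZ ht pq l lp lq ln lw.
have [sv gv'] := gv.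
have lE j : bary v (v g + t *: axis b) j = l j by rewrite bary_translate.
have gx : grid k (v g + t *: axis b).
  apply: grid_translate => //.
  by case/orP: ht => /eqP ->; rewrite lexx ?ler0n.
have [gu cu] : grid_simplex k (upd v w (v g + t *: axis b)) /\
    reachable k (convex_hull (range v))
      (convex_hull (range (upd v w (v g + t *: axis b)))).
  by apply: (@exchange _ _ _ _ _ _ p q n); rewrite ?lE.
exists (v g + t *: axis b), g; split=> //.
  by rewrite (extreme_height b) height_translate.
by move=> j ji; rewrite axis_other.
Qed.

(** Sliding w along the axis in the direction in which its own coordinate grows
keeps that coordinate positive, while p and n get opposite signs. *)
Lemma improvable_mixed v w p n : grid_simplex k v -> ~~ extreme (v w) ->
  p != w -> 0 < dir_coord v (axis false) p ->
  n != w -> dir_coord v (axis false) n < 0 ->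
  improvable v w.
Proof.
move=> gv; have [sv gv'] := gv; have [hZ h0 h1] := grid_height false (gv' w).
rewrite (extreme_height false) negb_or => /andP[hN0 hNk] pw ap nw an.
set h := height false (v w) in hZ h0 h1 hN0 hNk *.
have H0 : 0 < h by rewrite lt_def hN0.
have H1 : h < k%:R by rewrite lt_neqAle hNk.
case: (leP 0 (dir_coord v (axis false) w)) => aw.
  apply: (@improvableI false v w w (k%:R - h) w p n) => //.
  - by rewrite rpredB // rpred_nat.
  - by rewrite -/h subrKC eqxx orbT.
  - by rewrite eq_sym.
  - by rewrite eqxx /=; nra.
  - by rewrite (negbTE pw) /=; nra.
  - by rewrite (negbTE nw) /=; nra.
  - by apply: lt0r_neq0; rewrite eqxx /=; nra.
apply: (@improvableI false v w w (- h) w n p) => //.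
- by rewrite rpredN.
- by rewrite -/h subrr eqxx.
- by rewrite eq_sym.
- by rewrite eqxx /=; nra.
- by rewrite (negbTE nw) /=; nra.
- by rewrite (negbTE pw) /=; nra.
- by apply: lt0r_neq0; rewrite eqxx /=; nra.
Qed.

(** Sliding g keeps its own coordinate at 1 and makes those at w and n opposite
and nonzero. Both directions are allowed, so one of the ends can be reached. *)
Lemma improvable_edge b v w n g : (0 < k)%N -> grid_simplex k v ->
  n != w -> g != w -> g != n -> dir_coord v (axis b) w != 0 ->
  dir_coord v (axis b) n = - dir_coord v (axis b) w ->
  dir_coord v (axis b) g = 0 ->
  improvable v w.
Proof.
move=> k0 gv nw gw gn aw an ag; have [sv gv'] := gv.
have [hZ h0 h1] := grid_height b (gv' g).
have kR : 0 < k%:R :> R by rewrite ltr0n.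
have [t [tZ ht t0]] : exists t : R, [/\ t \is a Num.int,
    (height b (v g) + t == 0) || (height b (v g) + t == k%:R) & t != 0].
  case: (eqVneq (height b (v g)) k%:R) => hg.
    exists (- k%:R); rewrite rpredN rpred_nat hg subrr eqxx oppr_eq0 lt0r_neq0 //.
  exists (k%:R - height b (v g)); rewrite rpredB ?rpred_nat // subrKC eqxx orbT.
  by rewrite subr_eq0 eq_sym.
have tw : t * dir_coord v (axis b) w != 0 by rewrite mulf_neq0.
case: (ltP 0 (t * dir_coord v (axis b) w)) => tw0.
  apply: (@improvableI b v w g t g w n) => //.
  - by rewrite eqxx ag mulr0 addr0.
  - by rewrite [w == g]eq_sym (negbTE gw) add0r.
  - by rewrite eq_sym (negbTE gn) add0r an mulrN oppr_lt0.
  - by rewrite [w == g]eq_sym (negbTE gw) add0r.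
have {}tw0 : t * dir_coord v (axis b) w < 0 by rewrite lt_neqAle tw.
apply: (@improvableI b v w g t g n w) => //.
- by rewrite eqxx ag mulr0 addr0.
- by rewrite eq_sym (negbTE gn) add0r an mulrN oppr_gt0.
- by rewrite [w == g]eq_sym (negbTE gw) add0r.
- by rewrite [w == g]eq_sym (negbTE gw) add0r.
Qed.

Lemma upd_upd v w x y : upd (upd v w x) w y = upd v w y.
Proof. by apply/funext => j; rewrite /upd; case: eqP. Qed.

(** Going down from a vertex g other than w to height 0 gives a negative
coordinate at w and positive ones at g and at whichever of n1 and n2 differs
from g. When all the vertices but w are at height 0, the coefficient at w is
the inverse of the height of w, so at most 1, and the one at n1 is smaller in
absolute value because n2 takes a share: the point one unit above n1 keeps a
positive coordinate at n1. *)
Lemma improvable_apex b v w n1 n2 : (0 < k)%N -> grid_simplex k v ->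
  ~~ extreme (v w) ->
  n1 != w -> n2 != w -> n1 != n2 -> 0 < dir_coord v (axis b) w ->
  (forall j, j != w -> dir_coord v (axis b) j <= 0) ->
  dir_coord v (axis b) n1 < 0 -> dir_coord v (axis b) n2 < 0 -> improvable v w.
Proof.
move=> k0 gv; have [sv gv'] := gv; have [hZ h0 h1] := grid_height b (gv' w).
rewrite (extreme_height b) negb_or => /andP[hN0 hNk] n1w n2w n12 aw aj a1 a2.
have H0 : 0 < height b (v w) by rewrite lt_def hN0.
have H1 : 1 <= height b (v w).
  by rewrite -(ger0_norm h0) norm_intr_ge1.
have H2 : 1 < k%:R :> R.
  by apply: le_lt_trans H1 _; rewrite lt_neqAle hNk.
case: (pselect (exists2 g, g != w & 0 < height b (v g)));
  [move=> [g gw hg]|move=> /forall2NP low].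
  have [hgZ _ _] := grid_height b (gv' g).
  have [n ng an] : exists2 n, n != g & n != w /\ dir_coord v (axis b) n < 0.
    case: (eqVneq n1 g) => [n1g|]; last by exists n1.
    by exists n2; rewrite // -n1g eq_sym.
  case: an => nw an; have ag := aj g gw.
  apply: (@improvableI b v w g (- height b (v g)) g n w) => //.
  - by rewrite rpredN.
  - by rewrite subrr eqxx.
  - by rewrite eq_sym.
  - by rewrite eqxx /=; nra.
  - by rewrite (negbTE ng) /=; nra.
  - by rewrite eq_sym (negbTE gw) /=; nra.
  - by apply: ltr0_neq0; rewrite eq_sym (negbTE gw) /=; nra.
have low' g : g != w -> height b (v g) = 0.
  move=> gw; have [_ hg0 _] := grid_height b (gv' g); apply/eqP.
  rewrite eq_le hg0 andbT leNgt; apply/negP => hg.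
  by have [] := low g.
have aw1 : dir_coord v (axis b) w <= 1.
  have := height_direction b sv; rewrite (bigD1 w) //= big1 ?addr0; last first.
    by move=> j jw; rewrite low' // mulr0.
  by move=> <-; rewrite ler_peMr // ltW.
(* The coefficients sum to 0; the one at w is at most 1, the one at n2 is
   negative and the remaining ones are nonpositive. *)
have a1' : - 1 < dir_coord v (axis b) n1.
  have [s0 _] := dir_coord_sum (axis b) sv; move: s0.
  rewrite (bigD1 w) //= (bigD1 n1) //= (bigD1 n2) /=; last by rewrite n2w eq_sym.
  set s := \sum_(_ | _) _; suff : s <= 0 by lra.
  by apply: sumr_le0 => j /andP[/andP[jw _] _]; exact: aj.
pose y := v n1 + 1 *: axis b.
have yE j : bary v y j = (j == n1)%:R + 1 * dir_coord v (axis b) j.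
  by rewrite bary_translate.
have gy : grid k y.
  apply: grid_translate => //; rewrite low' // add0r ler01 /=.
  exact: ltW.
have [gu cu] : grid_simplex k (upd v w y) /\
    reachable k (convex_hull (range v)) (convex_hull (range (upd v w y))).
  apply: (@exchange _ _ _ _ _ _ w n1 n2); rewrite ?yE //.
  - by rewrite eq_sym.
  - by rewrite eq_sym (negbTE n1w) add0r mul1r.
  - by rewrite eqxx mul1r /=; lra.
  - by rewrite eq_sym (negbTE n12) add0r mul1r.
  - by rewrite [w == n1]eq_sym (negbTE n1w) add0r mul1r lt0r_neq0.
(* The new vertex y lies one unit above n1: an edge is parallel to the axis. *)
have aE j : dir_coord (upd v w y) (axis b) j = (j == w)%:R - (j == n1)%:R.
  rewrite -(dir_coord_vertices _ _ _ (proj1 gu)) upd_same upd_other //.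
  by rewrite {3}/y scale1r [v n1 + _]addrC addrK.
have [x [g [ex xg gx cx]]] : improvable (upd v w y) w.
  apply: (@improvable_edge b _ w n1 n2) => //; rewrite ?aE.
  - by rewrite eq_sym.
  - by rewrite eqxx [w == n1]eq_sym (negbTE n1w) subr0 oner_eq0.
  - by rewrite !eqxx [w == n1]eq_sym (negbTE n1w) subr0 sub0r.
  - by rewrite (negbTE n2w) eq_sym (negbTE n12) subr0.
rewrite upd_upd in gx cx; exists x, (if g == w then n1 else g); split=> //.
  move=> j ji; rewrite xg //; case: eqVneq => [->|gw]; last by rewrite upd_other.
  by rewrite upd_same axis_other.
exact: rt_trans cu cx.
Qed.

Lemma dir_coord_neq0 b v : simplex v -> exists j, dir_coord v (axis b) j != 0.
Proof.
move=> sv; apply: contrapT => /forallNP a0.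
have := height_direction b sv; rewrite big1 => [/eqP|j _].
  by rewrite eq_sym oner_eq0.
by have /negP := a0 j; rewrite negbK => /eqP ->; rewrite mul0r.
Qed.

(** The coefficients sum to 0 and are not all 0, so the one at w is positive and
another one is negative; whether there is a second negative one decides between
a vertical edge and an apex over a larger face. *)
Lemma improvable_pointed b v w : (0 < k)%N -> grid_simplex k v ->
  ~~ extreme (v w) ->
  (forall j, j != w -> dir_coord v (axis b) j <= 0) -> improvable v w.
Proof.
move=> k0 gv ew aj; have [sv gv'] := gv; have [s0 _] := dir_coord_sum (axis b) sv.
move: s0; rewrite (bigD1 w) //= => s0.
have [n nw an] : exists2 n, n != w & dir_coord v (axis b) n < 0.
  apply: contrapT => /forall2NP nn.
  have aj0 j : j != w -> dir_coord v (axis b) j = 0.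
    move=> jw; apply/eqP; rewrite eq_le aj //= leNgt; apply/negP => aj'.
    by have [] := nn j.
  have [j /eqP] := dir_coord_neq0 b sv; apply.
  have [->|/aj0//] := eqVneq j w.
  by move: s0; rewrite big1 ?addr0.
case: (pselect (exists n', [/\ n' != w, n' != n & dir_coord v (axis b) n' < 0])).
  move=> [n' [n'w n'n an']].
  apply: (@improvable_apex b v w n n') => //; first by rewrite eq_sym.
  have : \sum_(j | j != w) dir_coord v (axis b) j < 0; last by lra.
  rewrite (bigD1 n) //=.
  have : \sum_(j | (j != w) && (j != n)) dir_coord v (axis b) j <= 0; last by lra.
  by apply: sumr_le0 => j /andP[jw _]; exact: aj.
move=> /forallNP nn.
have aj0 j : j != w -> j != n -> dir_coord v (axis b) j = 0.
  move=> jw jn; apply/eqP; rewrite eq_le aj //= leNgt; apply/negP => aj'.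
  by apply: (nn j).
have awn : dir_coord v (axis b) n = - dir_coord v (axis b) w.
  apply/eqP; rewrite -addr_eq0 addrC; apply/eqP; rewrite -s0 (bigD1 n) //=.
  by rewrite big1 ?addr0 // => j /andP[]; exact: aj0.
(* A third vertex exists because d >= 2. *)
have [g [gw gn]] : exists g : 'I_(1 + d), g != w /\ g != n.
  have /card_gt0P[g] : (0 < #|[predC [:: w; n]]|)%N.
    rewrite -(ltn_add2l #|[:: w; n]|) cardC addn0 card_ord.
    by apply: leq_ltn_trans (card_size _) _.
  by rewrite !inE negb_or => /andP[? ?]; exists g.
apply: (@improvable_edge b v w n g) => //; last exact: aj0.
by rewrite -oppr_eq0 -awn ltr0_neq0.
Qed.

(** If the coefficients away from w do not take both signs, one of the two
orientations of the axis makes them all nonpositive. *)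
Lemma improve v w : (0 < k)%N -> grid_simplex k v -> ~~ extreme (v w) ->
  improvable v w.
Proof.
move=> k0 gv ew.
case: (pselect (exists2 p, p != w & 0 < dir_coord v (axis false) p));
  [move=> [p pw ap]|]; last first.
  move=> /forall2NP np; apply: (@improvable_pointed false) => // j jw.
  by rewrite leNgt; apply/negP => aj; have [] := np j.
case: (pselect (exists2 n, n != w & dir_coord v (axis false) n < 0));
  [move=> [n nw an]|].
  by apply: (@improvable_mixed _ _ p n).
move=> /forall2NP nn; apply: (@improvable_pointed true) => // j jw.
have : 0 <= dir_coord v (axis false) j.
  by rewrite leNgt; apply/negP => aj; have [] := nn j.
suff -> : dir_coord v (axis true) j = - dir_coord v (axis false) j.
  by rewrite oppr_le0.
rewrite /dir_coord /coords /axis scaleN1r scale1r -[X in row_mx X _]oppr0 -opp_row_mx.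
by rewrite mulNmx mxE.
Qed.

End Step.

(** * From simplices to the corners of the cube *)

Section Corners.
Context {R : realType} {d : nat} {k : nat}.
Hypotheses (d_ge2 : (2 <= d)%N) (k_gt0 : (0 < k)%N).
Implicit Types (x y : 'rV[R]_d) (P : set 'rV[R]_d).
Implicit Types v : 'I_(1 + d) -> 'rV[R]_d.

(** The number of vertices with a non-extreme i-th coordinate decreases. *)
Lemma straighten i v : grid_simplex k v -> exists v',
  [/\ grid_simplex k v',
      reachable k (convex_hull (range v)) (convex_hull (range v')),
      forall j, extreme k i (v' j) &
      forall i', i' != i -> (forall j, extreme k i' (v j)) ->
        forall j, extreme k i' (v' j)].
Proof.
have [n] := ubnP #|[pred j | ~~ extreme k i (v j)]|.
elim: n v => // n IH v /ltnSE vn gv.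
case: (pickP [pred j | ~~ extreme k i (v j)]) => [w /= ew|ev]; last first.
  exists v; split=> // [|j]; first exact: rt_refl.
  by have := ev j; rewrite /= => /negbFE.
have [x [g [ex xg gu cu]]] := improve d_ge2 k_gt0 gv ew.
have [|v' [gv' cv' ev' sv']] := IH _ _ gu.
  apply: leq_trans vn; apply/proper_card/properP; split.
    by apply/fintype.subsetP => j; rewrite !inE /upd; case: eqP; rewrite ?ex.
  by exists w; rewrite !inE // upd_same negbK.
exists v'; split=> //; first exact: rt_trans cu cv'.
move=> i' ii' ei'; apply: sv' => // j; rewrite /upd; case: eqP => // _.
by rewrite /extreme xg //; exact: ei'.
Qed.

Definition corners : set 'rV[R]_d := [set x | forall i, extreme k i x].

Lemma finite_corners : finite_set corners.
Proof.
apply: (@sub_finite_set _ _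
  (range (fun f : {ffun 'I_d -> bool} => \row_i ((f i)%:R * k%:R) : 'rV[R]_d))).
  move=> x cx; exists [ffun i => x 0 i == k%:R] => //; apply/rowP => i.
  rewrite !mxE ffunE; case/orP: (cx i) => /eqP ->; last by rewrite eqxx mul1r.
  by rewrite eq_sym pnatr_eq0 (gtn_eqF k_gt0) mul0r.
by apply: finite_image; exact: finite_finset.
Qed.

Lemma corners_grid : corners `<=` grid k.
Proof.
move=> x cx; split=> i; case/orP: (cx i) => /eqP ->; rewrite ?rpred0 ?rpred_nat //.
  by rewrite lexx ler0n.
by rewrite ler0n lexx.
Qed.

Lemma spanning_corners : spanning corners.
Proof.
apply/seteqP; split=> // x _.
have kR : k%:R != 0 :> R by rewrite pnatr_eq0 -lt0n.
have -> : x = 0 + \sum_i (x 0 i / k%:R) *: (k%:R *: delta_mx 0 i).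
  rewrite add0r {1}[x]row_sum_delta; apply: eq_bigr => i _.
  by rewrite scalerA divfK.
apply: affine_set_sum; first exact: affine_set_hull.
  by apply: sub_gen_smallest => i; rewrite /extreme mxE eqxx.
move=> i; apply: sub_gen_smallest => j; rewrite /extreme !mxE add0r eqxx.
by case: (j == i); rewrite ?mulr1 ?mulr0 eqxx ?orbT.
Qed.

(** The l1 distance to the corner c is 0 at c and at least k at the other
corners. On the cube it is the sum of the heights, the i-th one being measured
from the side of c. *)
Lemma convex_position_corners : convex_position corners.
Proof.
move=> c cc; pose h i := @height R d k i (c 0 i != 0).
have hc i : h i c = 0.
  rewrite /h /height; case: eqVneq => //= c0.
  by case/orP: (cc i) => /eqP E; [rewrite E eqxx in c0|rewrite E subrr].
apply: (convex_hull_separated (f := fun x => k%:R - \sum_i h i x)).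
- move=> x y t; rewrite mulrBr mulrBr.
  suff -> : \sum_i h i (t *: x + (1 - t) *: y) =
      t * (\sum_i h i x) + (1 - t) * \sum_i h i y by ring.
  rewrite !mulr_sumr -big_split; apply: eq_bigr => i _.
  by rewrite /h /height; case: ifP => _; rewrite !mxE /=; ring.
- move=> x [cx xc]; rewrite subr_le0.
  have h0 i : 0 <= h i x.
    by have [] := grid_height i (c 0 i != 0) (corners_grid cx).
  have [i xi] : exists i, x 0 i != c 0 i.
    apply: contrapT => /forallNP E; apply: xc; apply/rowP => i.
    by apply/eqP; rewrite -[_ == _]negbK; apply/negP; exact: E.
  rewrite (bigD1 i) //= -[leLHS]addr0 lerD ?sumr_ge0 //.
  rewrite /h /height; case/orP: (cx i) => /eqP xE; case/orP: (cc i) => /eqP cE;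
    move: xi; rewrite xE cE ?eqxx //= => kc; rewrite ?kc ?subr0 //.
  by rewrite eq_sym (negbTE kc).
- by rewrite big1 // subr0 ltr0n.
Qed.

Lemma straighten_all v : grid_simplex k v -> exists v',
  [/\ grid_simplex k v',
      reachable k (convex_hull (range v)) (convex_hull (range v')) &
      range v' `<=` corners].
Proof.
move=> gv.
suff [v' [gv' cv' ev']] : exists v', [/\ grid_simplex k v',
    reachable k (convex_hull (range v)) (convex_hull (range v')) &
    forall i, i \in enum 'I_d -> forall j, extreme k i (v' j)].
  exists v'; split=> // _ [j _ <-] i; apply: ev'; exact: mem_enum.
elim: (enum 'I_d) => [|i s [v' [gv' cv' ev']]].
  by exists v; split=> //; exact: rt_refl.
have [v2 [gv2 cv2 ev2 sv2]] := straighten i gv'.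
exists v2; split=> //; first exact: rt_trans cv' cv2.
move=> i'; rewrite inE; have [-> //|/= ii' i's] := eqVneq i' i.
by apply: sv2 => //; exact: ev'.
Qed.

(** A square submatrix of full rank of the homogeneous coordinates of the
vertices of P selects the vertices of a simplex. *)
Lemma grid_simplex_in P : Lambda_vertex k P -> exists v,
  grid_simplex k v /\ reachable k P (convex_hull (range v)).
Proof.
move=> [[pP vP] /has_dimension_spanning sP Pk].
have [fV cV hV] := polytope_vertices pP.
have gV : vertices P `<=` grid k.
  by move=> x Vx; split; [exact: vP|apply: Pk; case: Vx].
have sV : spanning (vertices P) by apply/spanning_hull; rewrite hV.
have /finite_seqP[s sE] := fV.
pose w (j : 'I_(size s)) := tnth (in_tuple s) j.
have wE : range w = vertices P.
  rewrite sE; apply/seteqP; split=> [_ [j _ <-]|x /= /(tnthP (in_tuple s))[j ->]].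
    exact: mem_tnth.
  by exists j.
have fw : row_full (homog_mx w) by apply: spanning_row_full; rewrite wE.
pose v j := w (fullrankfun fw j).
have vw : range v `<=` vertices P.
  by move=> _ [j _ <-]; rewrite -wE; exists (fullrankfun fw j).
have sv : simplex v.
  rewrite /simplex; suff -> : homog_mx v = rowsub (fullrankfun fw) (homog_mx w).
    exact: fullrowsub_unit.
  by apply/row_matrixP => j; rewrite row_rowsub !rowK.
exists v; split; first by split=> // j; apply/gV/vw; exists j.
apply: reachable_sym; rewrite -hV; apply: reachable_sub => //.
exact: spanning_simplex.
Qed.

Lemma reachable_corners P : Lambda_vertex k P ->
  reachable k P (convex_hull corners).
Proof.
move=> /grid_simplex_in[v [gv cP]].
have [v' [[sv' _] cv' v'c]] := straighten_all gv.
apply: rt_trans cP (rt_trans _ _ _ _ _ cv' _).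
apply: reachable_sub => //; last exact: spanning_simplex.
- exact: finite_corners.
- exact: convex_position_corners.
- exact: corners_grid.
Qed.

End Corners.

Theorem corollary4p2 (R : realType) (d : nat) (hd : (2 <= d)%N)
  (k : nat) (hk : (0 < k)%N) :
  graph_connected (Lambda R d k).
Proof.
split=> [|P Q LP LQ].
  exists (convex_hull (@corners R d k)); apply: Lambda_vertex_hull.
  - exact: finite_corners.
  - exact: convex_position_corners.
  - exact: corners_grid.
  - exact: spanning_corners.
exact: rt_trans (reachable_corners hd hk LP)
  (reachable_sym (reachable_corners hd hk LQ)).
Qed.
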